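(* Let $m\ge1$ and let $\epsilon=(\epsilon_1,\epsilon_2,\dots,\epsilon_s)$ be a circular sequence of $s\ge2$ integers, and let $\epsilon'=(\epsilon_1+\epsilon_2,\epsilon_3,\dots,\epsilon_s)$. If $\epsilon_1\epsilon_2>0$, then $c(\Gamma^m_\epsilon)=c(\Gamma^m_{\epsilon'})$ and $\ell(\Gamma^m_\epsilon)=\ell(\Gamma^m_{\epsilon'})$.
   Context: Digraph $\Gamma^m_\epsilon$ of a circular integer sequence $\epsilon=(\epsilon_1,\dots,\epsilon_s)$ (indices mod $s$): vertices $x_{i,t}$, $0\le i\le m-1$, $t\in\{1,\dots,s\}$, some ''marked zero''. If $s=1$: if $\epsilon_1\ne0$ all vertices are marked zero and there are no edges; if $\epsilon_1=0$ nothing is marked and each $x_{i,1}$ carries a loop of weight $0$. If $s\ge2$: for each $t$ let $A_t=\max(\epsilon_t,0)$, $B_t=\max(-\epsilon_{t+1},0)$; for each $j\in\{0,\dots,m-1\}$: if $j\ge\max(A_t,B_t)$ add an edge from $x_{j-A_t,t}$ to $x_{j-B_t,t+1}$ of weight $A_t-B_t$; if $A_t\le j<B_t$ mark $x_{j-A_t,t}$ zero; if $B_t\le j<A_t$ mark $x_{j-B_t,t+1}$ zero. Each connected component is a directed path (linear digraph, possibly a single vertex) or a directed cycle (circular digraph); a linear digraph with no vertex marked zero is a free linear digraph. $\ell(\cdot)$ = number of free linear digraphs, $c(\cdot)$ = number of circular digraphs. *)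

(* Defs.v *)
From mathcomp Require Import all_boot all_order all_algebra.

Set Implicit Arguments.
Unset Strict Implicit.
Unset Printing Implicit Defensive.

Import Order.TTheory GRing.Theory Num.Theory.
Local Open Scope ring_scope.

(* There is at most one edge between two given vertices; [wd_weight x y] is
   meaningful only when [wd_edge x y] holds. *)
Record wdigraph (V : finType) := WDigraph {
  wd_edge : rel V;
  wd_weight : V -> V -> int;
  wd_marked : pred V
}.

Section Components.
Context (V : finType) (G : wdigraph V).

Definition adjacent : rel V := [rel x y | wd_edge G x y || wd_edge G y x].

Definition component (x : V) : {set V} := [set y | connect adjacent x y].

Definition components : {set {set V}} := [set component x | x : V].

(* In both predicates [p] lists the vertices of [C] without repetition, and the
   edges inside [C] are exactly those between consecutive entries of [p];
   a single vertex is linear without a loop and circular with one. *)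
Definition linear_digraph (C : {set V}) : bool :=
  [exists p : #|C|.-tuple V,
    [&& uniq p, [set x in p] == C &
      [forall x in C, forall y in C,
        wd_edge G x y == (index y p == (index x p).+1)]]].

Definition circular_digraph (C : {set V}) : bool :=
  [exists p : #|C|.-tuple V,
    [&& uniq p, [set x in p] == C &
      [forall x in C, forall y in C, wd_edge G x y == (y == next p x)]]].

Definition free_linear_digraph (C : {set V}) : bool :=
  linear_digraph C && [forall x in C, ~~ wd_marked G x].

Definition num_free_linear : nat :=
  #|[set C in components | free_linear_digraph C]|.

Definition num_circular : nat :=
  #|[set C in components | circular_digraph C]|.

End Components.

Section Gamma.
Context (m : nat) (eps : seq int).

(* [(i, t)] stands for x_{i,t+1}: columns are numbered from 0, cyclically. *)
Definition gamma_vertex : finType := ('I_m * 'I_(size eps))%type.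

Definition gamma_A (t : 'I_(size eps)) : nat := absz (Num.max eps`_t 0).

Definition gamma_B (t : 'I_(size eps)) : nat := absz (Num.max (- eps`_(ordS t)) 0).

Definition gamma_edge (x y : gamma_vertex) : bool :=
  if size eps == 1%N then (eps`_0 == 0) && (x == y)
  else [exists t : 'I_(size eps), exists j : 'I_m,
    [&& (maxn (gamma_A t) (gamma_B t) <= j)%N,
        x.2 == t, x.1 == (j - gamma_A t)%N :> nat,
        y.2 == ordS t & y.1 == (j - gamma_B t)%N :> nat]].

Definition gamma_weight (x y : gamma_vertex) : int :=
  if size eps == 1%N then 0
  else (gamma_A x.2)%:Z - (gamma_B x.2)%:Z.

Definition gamma_marked (x : gamma_vertex) : bool :=
  if size eps == 1%N then eps`_0 != 0
  else [exists t : 'I_(size eps), exists j : 'I_m,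
    [&& (gamma_A t <= j < gamma_B t)%N,
        x.2 == t & x.1 == (j - gamma_A t)%N :> nat]
    || [&& (gamma_B t <= j < gamma_A t)%N,
        x.2 == ordS t & x.1 == (j - gamma_B t)%N :> nat]].

Definition Gamma : wdigraph gamma_vertex :=
  WDigraph gamma_edge gamma_weight gamma_marked.

End Gamma.

(* Main.v *)
(** Every vertex has at most one successor and at most one predecessor, so a
    component is circular when all its vertices have a predecessor, and linear
    otherwise.  When [e1] and [e2] are positive, column 1 of [Gamma m [:: e1, e2 & r]]
    can be deleted, joining the predecessor and the successor of each of its
    vertices and passing its marks on to its neighbours; the result is
    [Gamma m (e1 + e2 :: r)].  A deleted vertex without neighbours is marked, so no
    circular or free linear component disappears.  When [e1] and [e2] are negative,
    column 0 plays this role.  If [r] is empty, the graph with a single column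
    follows another rule, but then all four numbers are 0: a vertex of least height
    in its component is marked and has no predecessor (no successor for negative
    entries). *)

Require Import Defs.
From mathcomp Require Import all_boot all_order all_algebra zify.

Set Implicit Arguments.
Unset Strict Implicit.
Unset Printing Implicit Defensive.

Import Order.TTheory GRing.Theory Num.Theory.
Local Open Scope ring_scope.

(** * Components of digraphs with in-degree and out-degree at most one *)

Section PartialInjection.
Context (V : finType) (G : wdigraph V).
Implicit Types (x y z : V) (C : {set V}).

Lemma connect_adjacentC : connect_sym (adjacent G).
Proof. by apply: sym_connect_sym => x y; rewrite /adjacent /= orbC. Qed.

Lemma edge_component x y z :
  wd_edge G y z -> (y \in component G x) = (z \in component G x).
Proof.
move=> yz; rewrite !inE.
by apply: (same_connect_r connect_adjacentC); apply: connect1; rewrite /adjacent /= yz.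
Qed.

Lemma mem_component x : x \in component G x.
Proof. by rewrite inE connect0. Qed.

Lemma component_eq x y : (component G x == component G y) = connect (adjacent G) x y.
Proof.
apply/eqP/idP => [e|xy]; first by have := mem_component y; rewrite -e inE.
by apply/setP => z; rewrite !inE (same_connect connect_adjacentC xy).
Qed.

Lemma closed_component x (S : {pred V}) :
    x \in S -> (forall y z, wd_edge G y z -> (y \in S) = (z \in S)) ->
  {subset component G x <= S}.
Proof.
move=> xS clS y; rewrite inE => xy.
have cl : closed (adjacent G) S by move=> u v /= /orP[/clS|/clS].
by rewrite -(closed_connect cl xy).
Qed.

(** The neighbours are [next p x] and [prev p x]; when [C] has one vertex both are [x] and the edge
    is its loop. *)
Lemma circular_digraph_edges C x :
  circular_digraph G C -> x \in C ->
  (exists2 y, y \in C & wd_edge G x y) /\ (exists2 y, y \in C & wd_edge G y x).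
Proof.
move=> /existsP[p /and3P[up /eqP pC /forall_inP E]] xC.
have memp z : (z \in C) = (z \in p) by have /setP/(_ z) := pC; rewrite inE => ->.
have nC : next p x \in C by rewrite memp mem_next -memp.
have vC : prev p x \in C by rewrite memp mem_prev -memp.
split; [exists (next p x) | exists (prev p x)] => //.
  by move/forall_inP: (E x xC) => /(_ _ nC)/eqP->; rewrite eqxx.
by move/forall_inP: (E _ vC) => /(_ _ xC)/eqP->; rewrite next_prev.
Qed.

Lemma linear_digraph_source C :
  linear_digraph G C -> C != set0 ->
  exists2 x, x \in C & forall y, y \in C -> ~~ wd_edge G y x.
Proof.
move=> /existsP[p /and3P[up /eqP pC /forall_inP E]] /set0Pn[x0].
have memp z : (z \in C) = (z \in p) by have /setP/(_ z) := pC; rewrite inE => ->.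
rewrite memp => x0p.
have p0 : (0 < size p)%N by rewrite -has_predT; apply/hasP; exists x0.
exists (nth x0 p 0); first by rewrite memp mem_nth.
move=> y yC; move/forall_inP: (E y yC) => /(_ (nth x0 p 0)).
by rewrite memp mem_nth // => /(_ isT)/eqP->; rewrite index_uniq.
Qed.

Context (edge_fun : forall x y z, wd_edge G x y -> wd_edge G x z -> y = z)
  (edge_inj : forall x y z, wd_edge G x z -> wd_edge G y z -> x = y).

(** Totalised so that [orbit] and [order] apply. A vertex without out-edge becomes a fixed point,
    just like a vertex with a loop, so a value of [succ] certifies an edge only where it differs
    from its argument. *)
Definition succ x := odflt x [pick y | wd_edge G x y].

Lemma succ_edge x y : wd_edge G x y -> succ x = y.
Proof.
by move=> xy; rewrite /succ; case: pickP => [z /(edge_fun xy)|/(_ y)/=]; rewrite ?xy.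
Qed.

Lemma edge_succ x : succ x != x -> wd_edge G x (succ x).
Proof. by rewrite /succ; case: pickP => //= _; rewrite eqxx. Qed.

(** Going backwards, an edge into the iterate of rank [k.+1] starts at the iterate of rank [k] by
    injectivity, and edges into [x0] are covered by the hypothesis. That hypothesis is met both by a
    source and by a vertex on a cycle. *)
Lemma orbit_succ_closed x0 :
    (forall z, wd_edge G z x0 -> z \in orbit succ x0) ->
  forall y z, wd_edge G y z -> (y \in orbit succ x0) = (z \in orbit succ x0).
Proof.
move=> x0P y z yz; rewrite -!fconnect_orbit; apply/idP/idP => [x0y|].
  by rewrite -(succ_edge yz); apply: connect_trans x0y (fconnect1 _ _).
move=> /iter_findex; move: (findex _ _ _) => k.
elim: k y z yz => [|k IH] y z yz /= ez.
  by rewrite fconnect_orbit x0P // ez.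
(* If [succ] stalls at rank [k], then [z] is already the iterate of rank [k]; otherwise the last
   step is a genuine edge. *)
have [e|ne] := eqVneq (succ (iter k succ x0)) (iter k succ x0).
  by apply: IH yz _; rewrite -ez e.
have := edge_succ ne; rewrite ez => /(edge_inj yz) ->.
exact: fconnect_iter.
Qed.

Lemma component_orbit x0 :
    (forall z, wd_edge G z x0 -> z \in orbit succ x0) ->
  component G x0 = [set x in orbit succ x0].
Proof.
move=> x0P; apply/eqP; rewrite eqEsubset; apply/andP; split; apply/subsetP => y.
  rewrite [in X in _ -> X]inE; apply: closed_component; last exact: orbit_succ_closed.
  by rewrite -fconnect_orbit connect0.
rewrite inE -fconnect_orbit => /iter_findex <-.
elim: (findex _ _ _) => [|k IH] /=; first exact: mem_component.
have [->//|ne] := eqVneq (succ (iter k succ x0)) (iter k succ x0).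
by rewrite -(edge_component _ (edge_succ ne)).
Qed.

(** The orbit of the source, in its natural order, is the required listing of the component. *)
Lemma source_linear x0 :
  (forall z, ~~ wd_edge G z x0) -> linear_digraph G (component G x0).
Proof.
move=> src; have eC : component G x0 = [set x in orbit succ x0].
  by apply: component_orbit => z zx; have := src z; rewrite zx.
have sz : size (orbit succ x0) == #|component G x0|.
  by rewrite eC cardsE (card_uniqP _) ?orbit_uniq.
apply/existsP; exists (Tuple sz) => /=; rewrite orbit_uniq -eC eqxx /=.
apply/forall_inP => x; rewrite eC inE => xC.
apply/forall_inP => y; rewrite inE => yC; apply/eqP.
have ix : (index x (orbit succ x0) < order succ x0)%N by rewrite -(size_orbit succ) index_mem.
have iy : (index y (orbit succ x0) < order succ x0)%N by rewrite -(size_orbit succ) index_mem.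
have nthE k : (k < order succ x0)%N -> nth x0 (orbit succ x0) k = iter k succ x0.
  by move=> kn; rewrite /orbit nth_traject.
have indexE k : (k < order succ x0)%N -> index (iter k succ x0) (orbit succ x0) = k.
  by move=> kn; rewrite -nthE // index_uniq ?size_orbit ?orbit_uniq.
have ex : x = iter (index x (orbit succ x0)) succ x0 by rewrite -nthE // nth_index.
have ey : y = iter (index y (orbit succ x0)) succ x0 by rewrite -nthE // nth_index.
move: (index x _) (index y _) ix iy ex ey => i j iltn jltn -> ->.
(* The entries of an orbit are distinct, so [succ] does not stall before its end. *)
have step k : (k.+1 < order succ x0)%N -> wd_edge G (iter k succ x0) (iter k.+1 succ x0).
  move=> kn; apply: edge_succ; apply/eqP => e.
  by have := indexE _ kn; rewrite iterS e indexE ?(ltnW kn) // => ?; lia.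
apply/idP/eqP => [e|ji]; last by rewrite ji in jltn *; exact: step.
case: j jltn e => [_ e|j jltn e]; first by have := src (iter i succ x0); rewrite e.
by rewrite -(indexE _ iltn) (edge_inj e (step _ jltn)) indexE // ltnW.
Qed.

(** The predecessor map sends the component injectively into itself, hence onto itself by
    finiteness. So every vertex also has a successor, and the orbit of [x0] closes up into a
    cycle. *)
Lemma predecessors_circular x0 :
    (forall x, x \in component G x0 -> exists z, wd_edge G z x) ->
  circular_digraph G (component G x0).
Proof.
move=> hasp; set C := component G x0.
pose pr x := odflt x [pick z | wd_edge G z x].
have prE x : x \in C -> wd_edge G (pr x) x.
  by move=> /hasp[z zx]; rewrite /pr; case: pickP => // /(_ z); rewrite zx.
have prC : [set pr x | x in C] = C.
  apply/eqP; rewrite eqEcard; apply/andP; split.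
    by apply/subsetP => _ /imsetP[x xC ->]; rewrite (edge_component _ (prE x xC)).
  rewrite card_in_imset // => x y xC yC e; apply: edge_fun (prE x xC) _.
  by rewrite e prE.
have succE x : x \in C -> wd_edge G x (succ x).
  rewrite -{1}prC => /imsetP[y yC ->]; have e := prE y yC.
  by rewrite (succ_edge e).
have sC x : x \in C -> succ x \in C.
  by move=> xC; rewrite -(edge_component _ (succE x xC)).
have iC k : iter k succ x0 \in C.
  by elim: k => [|k IH]; [exact: mem_component | exact: sC].
(* The orbit closes at [x0] itself: a return to a later iterate would, by [edge_inj], give a
   repetition one step earlier, inside the orbit. *)
have iterC : iter (order succ x0) succ x0 = x0.
  have : looping succ x0 (order succ x0) by exact: looping_order.
  move=> /trajectP[[_ //|i] iln].
  rewrite -[order succ x0]prednK ?order_gt0 // !iterS => e.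
  have e1 : iter (order succ x0).-1 succ x0 = iter i succ x0.
    by apply: edge_inj (succE _ (iC _)) _; rewrite e succE.
  have := orbit_uniq succ x0; rewrite /orbit -(size_traject succ x0 (order succ x0)).
  move=> /(uniqP x0) /(_ i (order succ x0).-1).
  rewrite !inE !size_traject nth_traject ?nth_traject ?prednK ?order_gt0 // ?(ltnW iln) //.
  by move=> /(_ isT (leqnn _) (esym e1)); lia.
have cyc : fcycle succ (orbit succ x0).
  rewrite /orbit -[order succ x0]prednK ?order_gt0 //=.
  by rewrite rcons_path fpath_traject last_traject /= -iterS prednK ?order_gt0 ?iterC.
have eC : C = [set x in orbit succ x0].
  apply: component_orbit => z zx0.
  have := succE _ (iC (order succ x0).-1).
  rewrite -iterS prednK ?order_gt0 // iterC -fconnect_orbit => /(edge_inj zx0) ->.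
  exact: fconnect_iter.
have sz : size (orbit succ x0) == #|C|.
  by rewrite eC cardsE (card_uniqP _) ?orbit_uniq.
apply/existsP; exists (Tuple sz) => /=; rewrite orbit_uniq -eC eqxx /=.
apply/forall_inP => x xC; apply/forall_inP => y yC.
have /eqP <- : succ x == next (orbit succ x0) x.
  by apply: (next_cycle cyc); rewrite eC inE in xC.
apply/eqP; apply/idP/eqP => [/succ_edge //|->]; exact: succE.
Qed.

Lemma circular_componentP x :
  reflect (forall y, y \in component G x -> exists z, wd_edge G z y)
          (circular_digraph G (component G x)).
Proof.
apply: (iffP idP) => [C y yC|]; last exact: predecessors_circular.
by have [_ [z _ zy]] := circular_digraph_edges C yC; exists z.
Qed.

(** A component that is not circular contains a source and is the component of that source, while a
    circular one has no source. *)
Lemma linear_component x :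
  linear_digraph G (component G x) = ~~ circular_digraph G (component G x).
Proof.
apply/idP/idP => [/linear_digraph_source src|ncirc].
  apply/negP => circ; have [|y yC nopred] := src.
    by apply/set0Pn; exists x; exact: mem_component.
  by have [_ [z /nopred/negbTE->]] := circular_digraph_edges circ yC.
have [y yC nopred] : exists2 y, y \in component G x & forall z, ~~ wd_edge G z y.
  have : ~~ [forall y in component G x, exists z, wd_edge G z y].
    apply: contra ncirc => /forall_inP P; apply: predecessors_circular => y /P /existsP.
    by [].
  move=> /forall_inPn[y yC /existsPn nopred]; by exists y.
have /eqP -> : component G x == component G y by rewrite component_eq; rewrite inE in yC.
exact: source_linear.
Qed.

End PartialInjection.

(** * Deleting pairwise non-adjacent vertices while joining their neighbours; [f] embeds the kept
    vertices *)

Section Contraction.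
Context (V W : finType) (G : wdigraph V) (H : wdigraph W) (f : W -> V).
Context
  (edge_fun : forall x y z, wd_edge G x y -> wd_edge G x z -> y = z)
  (edge_inj : forall x y z, wd_edge G x z -> wd_edge G y z -> x = y)
  (edgeH_fun : forall x y z, wd_edge H x y -> wd_edge H x z -> y = z)
  (edgeH_inj : forall x y z, wd_edge H x z -> wd_edge H y z -> x = y)
  (f_inj : injective f)
  (removed_neighbour : forall z w, z \notin codom f -> adjacent G z w -> w \in codom f)
  (edgeHP : forall x y, wd_edge H x y <->
     wd_edge G (f x) (f y)
     \/ exists z, [/\ z \notin codom f, wd_edge G (f x) z & wd_edge G z (f y)])
  (markedHP : forall x, wd_marked H x <->
     wd_marked G (f x)
     \/ exists z, [/\ z \notin codom f, adjacent G z (f x) & wd_marked G z])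
  (isolated_marked : forall z, z \notin codom f ->
     (forall w, ~~ adjacent G z w) -> wd_marked G z).

Let adjacentC x y : adjacent G x y = adjacent G y x.
Proof. by rewrite /adjacent /= orbC. Qed.

(** Two edges at [z] of the same direction have the same other end; two of opposite directions are
    joined into one edge of [H]. *)
Lemma contraction_via z x y :
    z \notin codom f -> adjacent G z (f x) -> adjacent G z (f y) ->
  connect (adjacent H) x y.
Proof.
move=> zf /orP[zx|xz] /orP[zy|yz].
- by rewrite (f_inj (edge_fun zx zy)).
- apply: connect1; rewrite /adjacent /=; apply/orP; right.
  by apply/edgeHP; right; exists z.
- apply: connect1; rewrite /adjacent /=; apply/orP; left.
  by apply/edgeHP; right; exists z.
- by rewrite (f_inj (edge_inj xz yz)).
Qed.

Lemma contraction_adjacent x y : adjacent H x y -> connect (adjacent G) (f x) (f y).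
Proof.
have E u v : wd_edge H u v -> connect (adjacent G) (f u) (f v).
  move=> /edgeHP[uv|[z [_ uz zv]]]; first by apply: connect1; rewrite /adjacent /= uv.
  by apply: (@connect_trans _ _ z); apply: connect1; rewrite /adjacent /= ?uz ?zv.
by case/orP=> [/E //|/E]; rewrite connect_adjacentC.
Qed.

Lemma contraction_connect x y :
  connect (adjacent G) (f x) (f y) = connect (adjacent H) x y.
Proof.
apply/idP/idP; last first.
  move=> /connectP[p]; elim: p x => [|u p IH] x /= => [_ ->//|/andP[xu up] e].
  exact: connect_trans (contraction_adjacent xu) (IH _ up e).
(* A removed vertex cannot be compared with [x] directly: all its neighbours are instead. *)
pose R v := (forall u, v = f u -> connect (adjacent H) x u) /\
  (v \notin codom f -> forall u, adjacent G v (f u) -> connect (adjacent H) x u).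
have R0 : R (f x) by split=> [u /f_inj -> //|]; rewrite codom_f.
move=> /connectP[p]; move: R0; move: (f x) => v.
elim: p v => [|w p IH] v Rv /= => [_ e|/andP[vw wp] e]; first by apply: Rv.1.
apply: IH wp e; case: Rv => Rf Rn; split=> [u wE|wn u wu]; last first.
  have /codomP[v' vE] : v \in codom f by apply: removed_neighbour wn _; rewrite adjacentC.
  apply: connect_trans (Rf v' vE) (contraction_via wn _ wu).
  by rewrite adjacentC -vE.
have [/codomP[v' vE]|vn] := boolP (v \in codom f); last by apply: Rn; rewrite -?wE.
apply: connect_trans (Rf v' vE) (connect1 _).
move: vw; rewrite vE wE /adjacent /=.
by case/orP=> h; apply/orP; [left|right]; apply/edgeHP; left.
Qed.

Lemma preim_component x : f @^-1: component G (f x) = component H x.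
Proof. by apply/setP => y; rewrite !inE contraction_connect. Qed.

(** A path from [v] to the kept vertex [f x] is nonempty, and its first step already leads to a kept
    vertex. *)
Lemma removed_adjacent v x :
    v \notin codom f -> v \in component G (f x) ->
  exists2 y, adjacent G v (f y) & y \in component H x.
Proof.
move=> vn vC; have : connect (adjacent G) v (f x).
  by rewrite connect_adjacentC; rewrite inE in vC.
move=> /connectP[[|w p]] /=; first by move=> _ e; rewrite -e codom_f in vn.
move=> /andP[vw _] _; have /codomP[y e] := removed_neighbour vn vw.
exists y; first by rewrite -e.
rewrite inE in vC; rewrite -preim_component !inE -e.
exact: connect_trans vC (connect1 vw).
Qed.

(** Both sides are read as the existence of a predecessor for every vertex. If the predecessor in
    [G] of a kept vertex was removed, the predecessor of that one is kept and becomes the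
    predecessor in [H]. *)
Lemma contraction_circular x :
  circular_digraph G (component G (f x)) = circular_digraph H (component H x).
Proof.
apply/(circular_componentP edge_fun edge_inj)/(circular_componentP edgeH_fun edgeH_inj).
  move=> P y yC; have fyC : f y \in component G (f x) by rewrite -preim_component inE in yC.
  have [z zy] := P _ fyC.
  have [/codomP[z' e]|zn] := boolP (z \in codom f).
    by exists z'; apply/edgeHP; left; rewrite -e.
  have [|u uz] := P z; first by rewrite (edge_component _ zy).
  have /codomP[u' e] : u \in codom f.
    by apply: removed_neighbour zn _; rewrite /adjacent /= uz orbT.
  by exists u'; apply/edgeHP; right; exists z; rewrite -e.
move=> P v vC; have pred_f y : y \in component H x -> exists z, wd_edge G z (f y).
  by move=> /P[z /edgeHP[zy|[u [_ _ uy]]]]; [exists (f z) | exists u].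
have [/codomP[y e]|vn] := boolP (v \in codom f).
  by rewrite e; apply: pred_f; rewrite -preim_component inE -e.
have [y /orP[vy|yv] yC] := removed_adjacent vn vC; last by exists (f y).
(* The removed vertex [v] is the only predecessor of [f y], so the edge of [H] into [y] passes
   through [v] and supplies a predecessor of [v]. *)
have [z /edgeHP[zy|[u [_ zu uy]]]] := P y yC.
  by have := edge_inj vy zy => e; rewrite e codom_f in vn.
by exists (f z); rewrite (edge_inj vy uy).
Qed.

Lemma contraction_unmarked x :
  [forall v in component G (f x), ~~ wd_marked G v]
    = [forall y in component H x, ~~ wd_marked H y].
Proof.
apply/forall_inP/forall_inP => P.
  move=> y yC; have fyC : f y \in component G (f x) by rewrite -preim_component inE in yC.
  apply/negP => /markedHP[|[z [zn /orP zy Mz]]]; first exact/negP/P.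
  have zC : z \in component G (f x).
    by case: zy => /edge_component E; [rewrite E|rewrite -E].
  by have := P z zC; rewrite Mz.
move=> v vC; apply/negP => Mv.
have [/codomP[y e]|vn] := boolP (v \in codom f).
  have /P/negP[] : y \in component H x by rewrite -preim_component inE -e.
  by apply/markedHP; left; rewrite -e.
have [y vy /P/negP[]] := removed_adjacent vn vC.
by apply/markedHP; right; exists v.
Qed.

Lemma contraction_free x :
  free_linear_digraph G (component G (f x)) = free_linear_digraph H (component H x).
Proof.
by rewrite /free_linear_digraph !linear_component // contraction_circular contraction_unmarked.
Qed.

(** Preimage under [f] is a bijection between the counted components. Each of them meets the image
    of [f]: a removed vertex in it has a neighbour, or is unmarked and therefore not isolated, and
    its neighbours are kept. The disjunction in the second hypothesis lets one argument serve both
    counts. *)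
Lemma card_contraction (P : pred {set V}) (Q : pred {set W}) :
    (forall x, P (component G (f x)) = Q (component H x)) ->
    (forall z, P (component G z) -> exists w, adjacent G z w || ~~ wd_marked G z) ->
  #|[set C in components G | P C]| = #|[set C in components H | Q C]|.
Proof.
move=> PQ nonisolated.
have compP C : C \in components G -> P C -> exists x, C = component G (f x).
  move=> /imsetP[z _ ->] Pz.
  have [/codomP[x ->]|zn] := boolP (z \in codom f); first by exists x.
  have [w zw] : exists w, adjacent G z w.
    have [w /orP[zw|nM]] := nonisolated z Pz; first by exists w.
    apply/existsP; apply: contraNT nM => /existsPn; exact: isolated_marked.
  have /codomP[x e] := removed_neighbour zn zw.
  by exists x; apply/eqP; rewrite component_eq -e connect1.
rewrite -(@card_in_imset _ _ (fun C : {set V} => f @^-1: C)) => [|C D].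
  congr #|pred_of_set _|; apply/setP => D; rewrite !inE; apply/imsetP/andP => [[C]|[DC QD]].
    rewrite inE => /andP[CG PC] ->; have [x e] := compP C CG PC.
    by rewrite e preim_component imset_f // -PQ -e.
  case/imsetP: DC QD => x _ -> Qx; exists (component G (f x)); last by rewrite preim_component.
  by rewrite inE imset_f // PQ.
rewrite !inE => /andP[CG PC] /andP[DG PD].
have [x ->] := compP C CG PC; have [y ->] := compP D DG PD.
rewrite !preim_component => /eqP; rewrite component_eq => xy.
by apply/eqP; rewrite component_eq contraction_connect.
Qed.

Lemma num_circular_contraction : num_circular G = num_circular H.
Proof.
apply: card_contraction; first exact: contraction_circular.
move=> z circ; have [[w _ zw] _] := circular_digraph_edges circ (mem_component G z).
by exists w; rewrite /adjacent /= zw.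
Qed.

Lemma num_free_linear_contraction : num_free_linear G = num_free_linear H.
Proof.
apply: card_contraction; first exact: contraction_free.
move=> z /andP[_ /forall_inP /(_ z (mem_component G z)) nM].
by exists z; rewrite nM orbT.
Qed.

End Contraction.

(** The mark on [x] excludes a free linear component, and its missing out- or in-edges exclude a
    circular one. *)
Lemma num_components_eq0 (V : finType) (G : wdigraph V) :
    (forall C, C \in components G ->
      exists x, [/\ x \in C, wd_marked G x
                  & (forall y, ~~ wd_edge G x y) \/ (forall y, ~~ wd_edge G y x)]) ->
  num_circular G = 0%N /\ num_free_linear G = 0%N.
Proof.
move=> P; split; apply/eqP; rewrite cards_eq0; apply/eqP/setP => C; rewrite !inE;
  apply/negP => /andP[/P[x [xC Mx nx]]].
  move=> circ; have [[y _ xy] [z _ zx]] := circular_digraph_edges circ xC.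
  by case: nx => [/(_ y)|/(_ z)]; rewrite ?xy ?zx.
by case/andP=> _ /forall_inP/(_ x xC); rewrite Mx.
Qed.

(** * Digraphs arranged in columns, with edges given by height shifts *)

(* The index [j] of the edge from x_{j-A_t,t} to x_{j-B_t,t+1} is [x.1 + A x.2]. *)
Definition layered m (T : finType) (S : T -> T) (A B : T -> nat)
    (G : wdigraph ('I_m * T)%type) : Prop :=
  (forall x y : 'I_m * T, wd_edge G x y =
     [&& y.2 == S x.2, x.1 + A x.2 == y.1 + B x.2 & x.1 + A x.2 < m]%N)
  /\ (forall x : 'I_m * T, wd_marked G x =
     (x.1 + A x.2 < minn (B x.2) m)%N
     || [exists t, (S t == x.2) && (x.1 + B t < minn (A t) m)%N]).

Section Layered.
Context (m : nat) (T : finType) (S : T -> T) (A B : T -> nat).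
Context (G : wdigraph ('I_m * T)%type) (GP : layered S A B G).

Lemma layered_edgeP (x y : 'I_m * T) :
  reflect [/\ y.2 = S x.2, (x.1 + A x.2 = y.1 + B x.2)%N & (x.1 + A x.2 < m)%N]
          (wd_edge G x y).
Proof.
rewrite GP.1; apply: (iffP and3P) => -[/eqP e1 /eqP e2 e3]; split=> //; exact/eqP.
Qed.

Lemma layered_markedP (x : 'I_m * T) :
  reflect ((x.1 + A x.2 < minn (B x.2) m)%N
           \/ exists2 t, S t = x.2 & (x.1 + B t < minn (A t) m)%N)
          (wd_marked G x).
Proof.
rewrite GP.2; apply: (iffP orP) => -[|]; [by left | | by left | ].
  by move=> /existsP[t /andP[/eqP]]; right; exists t.
by move=> [t /eqP e h]; right; apply/existsP; exists t; rewrite e.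
Qed.

Lemma layered_edge_fun x y z : wd_edge G x y -> wd_edge G x z -> y = z.
Proof.
case: y z => [i t] [j u] /layered_edgeP[/= -> e _] /layered_edgeP[/= -> e' _].
by congr (_, _); apply: val_inj => /=; lia.
Qed.

Lemma layered_edge_inj (S_inj : injective S) x y z :
  wd_edge G x z -> wd_edge G y z -> x = y.
Proof.
case: x y => [i t] [j u] /layered_edgeP[/= e1 e _] /layered_edgeP[/= e2 e' _].
have tu : t = u by apply: S_inj; rewrite -e1.
by rewrite -tu in e' *; congr (_, _); apply: val_inj => /=; lia.
Qed.

End Layered.

(** * Contraction of one column of a layered digraph *)

(* Column [k] is removed, [p] is (the index in [T'] of) the column before it. *)
Section ColumnContraction.
Context (m : nat) (T T' : finType) (S : T -> T) (S' : T' -> T').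
Context (A B : T -> nat) (A' B' : T' -> nat).
Context (G : wdigraph ('I_m * T)%type) (H : wdigraph ('I_m * T')%type).
Context (GP : layered S A B G) (HP : layered S' A' B' H).
Context (g : T' -> T) (k : T) (p : T').
Context (S_inj : injective S) (S'_inj : injective S') (g_inj : injective g)
  (k_codom : forall t, (t \in codom g) = (t != k))
  (Sgp : S (g p) = k) (Sk : S k = g (S' p))
  (Sg : forall t, t != p -> S (g t) = g (S' t))
  (A'p : A' p = (A (g p) + A k)%N) (B'p : B' p = (B (g p) + B k)%N)
  (A'g : forall t, t != p -> A' t = A (g t)) (B'g : forall t, t != p -> B' t = B (g t))
  (AB0 : A k = 0%N \/ B (g p) = 0%N).

Let f (x : 'I_m * T') : 'I_m * T := (x.1, g x.2).

Let fE z : (z \in codom f) = (z.2 != k).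
Proof.
rewrite -k_codom; apply/codomP/codomP => -[x e]; first by exists x.2; rewrite e.
by exists (z.1, x); rewrite /f /= -e; case: z {e}.
Qed.

Let fN z : z \notin codom f -> z.2 = k.
Proof. by rewrite fE negbK => /eqP. Qed.

Let g_neq t : g t != k.
Proof. by rewrite -k_codom codom_f. Qed.

Let succ_k z w : z.2 = k -> wd_edge G z w -> w.2 = g (S' p).
Proof. by move=> zk /(layered_edgeP GP)[-> _ _]; rewrite zk. Qed.

Let pred_k z w : z.2 = k -> wd_edge G w z -> w.2 = g p.
Proof. by move=> zk /(layered_edgeP GP)[+ _ _]; rewrite zk -Sgp => /S_inj. Qed.

Let removed_neighbour z w : z \notin codom f -> adjacent G z w -> w \in codom f.
Proof.
by rewrite (fE w) => /fN zk /orP[/(succ_k zk)|/(pred_k zk)] ->; exact: g_neq.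
Qed.

(** An edge of [H] leaving column [p] splits into two edges through column [k]. By [AB0] the middle
    height [i + A (g p) - B (g p)] is not truncated, and the two bounds by [m] amount to the single
    one in [H]. In [Gamma], [A k] and [B (g p)] are the positive and negative parts of one entry, so
    one of them vanishes. *)
Let edgeHP x y : wd_edge H x y <->
  wd_edge G (f x) (f y)
  \/ exists z, [/\ z \notin codom f, wd_edge G (f x) z & wd_edge G z (f y)].
Proof.
case: x y => [i t] [j u]; have [->|tp] := eqVneq t p; last first.
  split=> [/(layered_edgeP HP)[/= -> e lt]|[/(layered_edgeP GP)[/= e1 e2 e3]|]].
  - by left; apply/(layered_edgeP GP); rewrite /= Sg // -A'g // -B'g.
  - by apply/(layered_edgeP HP); rewrite /= A'g // B'g //; split=> //; apply: g_inj; rewrite -Sg.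
  by move=> [z [/fN zk /(pred_k zk) /g_inj /= e]]; rewrite e eqxx in tp.
split=> [/(layered_edgeP HP)[/= -> e lt]|[/(layered_edgeP GP)[/= e1 _ _]|]].
- right; rewrite A'p B'p in e lt.
  have zm : (i + A (g p) - B (g p) < m)%N by case: AB0; lia.
  exists (Ordinal zm, k); split; first by rewrite fE /= eqxx.
    by apply/(layered_edgeP GP); split=> //=; case: AB0; lia.
  by apply/(layered_edgeP GP); split=> //=; case: AB0; lia.
- by have := g_neq u; rewrite e1 Sgp eqxx.
move=> [[z v] [/fN /= -> /(layered_edgeP GP)[/= _ e1 lt1] /(layered_edgeP GP)[/= e2 e3 lt2]]].
apply/(layered_edgeP HP); rewrite /= A'p B'p.
have zm := ltn_ord z; have jm := ltn_ord j.
by split; [apply: g_inj; rewrite -Sk | lia | case: AB0; lia].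
Qed.

(** A mark caused by the combined step either already arises at the half-step next to the vertex, or
    that half-step is an edge and its end in column [k] carries the mark of the other half-step. *)
Let markedHP x : wd_marked H x <->
  wd_marked G (f x)
  \/ exists z, [/\ z \notin codom f, adjacent G z (f x) & wd_marked G z].
Proof.
case: x => [i t]; have im := ltn_ord i; split.
  move=> /(layered_markedP HP)[/= lt|[/= u <- lt]].
    have [e|tp] := eqVneq t p; last first.
      by left; apply/(layered_markedP GP); left; rewrite /= -A'g // -B'g.
    rewrite e A'p B'p in lt *.
    have [lt1|ge1] := ltnP (i + A (g p)) (minn (B (g p)) m).
      by left; apply/(layered_markedP GP); left.
    have zm : (i + A (g p) - B (g p) < m)%N by case: AB0; lia.
    right; exists (Ordinal zm, k); split; first by rewrite fE /= eqxx.
      apply/orP; right; apply/(layered_edgeP GP); split=> //=; case: AB0; lia.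
    by apply/(layered_markedP GP); left => /=; case: AB0; lia.
  have [e|up] := eqVneq u p; last first.
    left; apply/(layered_markedP GP); right; exists (g u); first by rewrite Sg.
    by rewrite /= -A'g // -B'g.
  rewrite e A'p B'p in lt *.
  have [lt1|ge1] := ltnP (i + B k) (minn (A k) m).
    by left; apply/(layered_markedP GP); right; exists k.
  have zm : (i + B k - A k < m)%N by case: AB0; lia.
  right; exists (Ordinal zm, k); split; first by rewrite fE /= eqxx.
    apply/orP; left; apply/(layered_edgeP GP); split=> //=; case: AB0; lia.
  by apply/(layered_markedP GP); right; exists (g p) => //=; case: AB0; lia.
have first_part :
    t = p -> (i + (A (g p) + A k) < minn (B (g p) + B k) m)%N -> wd_marked H (i, t).
  by move=> -> lt; apply/(layered_markedP HP); left; rewrite /= A'p B'p; lia.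
have second_part :
    t = S' p -> (i + (B (g p) + B k) < minn (A (g p) + A k) m)%N -> wd_marked H (i, t).
  by move=> -> lt; apply/(layered_markedP HP); right; exists p => //; rewrite A'p B'p /=; lia.
case=> [/(layered_markedP GP)[/= lt|[/= u e lt]]|[[z v] [/fN /= -> adj]]].
- have [e|tp] := eqVneq t p; first by rewrite e in lt; apply: first_part => //; case: AB0; lia.
  by apply/(layered_markedP HP); left; rewrite /= A'g // B'g.
- have [uk|uk] := eqVneq u k.
    apply: second_part; first by apply: g_inj; rewrite -Sk -uk.
    by move: lt; rewrite uk; case: AB0; lia.
  move: uk; rewrite -k_codom => /codomP[u' uE]; rewrite {}uE in e lt.
  have u'p : u' != p by apply: contraTneq (g_neq t) => u'p; rewrite negbK -e u'p Sgp.
  apply/(layered_markedP HP); right; exists u'; first by apply: g_inj; rewrite -Sg.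
  by rewrite A'g // B'g.
have zlt := ltn_ord z; move=> /(layered_markedP GP) /= M.
(* A vertex of column [k] is marked either as a missing start towards the next column or as a
   missing end from column [g p]. *)
have {M} Mz : (z + A k < minn (B k) m)%N \/ (z + B (g p) < minn (A (g p)) m)%N.
  by case: M => [|[u]]; [left | rewrite -Sgp => /S_inj ->; right].
case/orP: adj => /(layered_edgeP GP)[/= e1 e2 lt].
  by apply: second_part; [apply: g_inj; rewrite e1 | case: AB0 Mz => h []; lia].
have tp : t = p by apply/g_inj/S_inj; rewrite -e1.
by rewrite tp in e2 lt; apply: first_part => //; case: AB0 Mz => h []; lia.
Qed.

(** If [A k = 0], the missing out-edge forces the height below [B k]; if [B (g p) = 0], the missing
    in-edge forces it below [A (g p)]. Either inequality is a marking condition. *)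
Let isolated_marked z :
  z \notin codom f -> (forall w, ~~ adjacent G z w) -> wd_marked G z.
Proof.
case: z => i v /fN /= ->; have im := ltn_ord i => iso.
apply/(layered_markedP GP) => /=.
case: AB0 => h.
  left; rewrite ltnNge; apply/negP => ge.
  have zm : (i + A k - B k < m)%N by lia.
  have /negP[] := iso (Ordinal zm, g (S' p)).
  by apply/orP; left; apply/(layered_edgeP GP); split=> //=; lia.
right; exists (g p) => //; rewrite ltnNge; apply/negP => ge.
have zm : (i + B (g p) - A (g p) < m)%N by lia.
have /negP[] := iso (Ordinal zm, g p).
by apply/orP; right; apply/(layered_edgeP GP); split=> //=; lia.
Qed.

Lemma layered_contraction :
  num_circular G = num_circular H /\ num_free_linear G = num_free_linear H.
Proof.
have f_inj : injective f by move=> [i t] [j u] [-> /g_inj ->].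
have GF := layered_edge_fun GP; have GI := layered_edge_inj GP S_inj.
have HF := layered_edge_fun HP; have HI := layered_edge_inj HP S'_inj.
split.
  exact: (num_circular_contraction GF GI HF HI f_inj removed_neighbour edgeHP isolated_marked).
exact: (num_free_linear_contraction GF GI HF HI f_inj removed_neighbour edgeHP markedHP
  isolated_marked).
Qed.

End ColumnContraction.

(** Height strictly increases along edges in the first case and strictly decreases in the second. A
    lowest vertex of a component thus has no predecessor, respectively no successor; since the shift
    towards that missing neighbour would leave the range of heights, the vertex is marked. *)
Lemma layered_one_sign m (T : finType) (S : T -> T) (A B : T -> nat)
    (G : wdigraph ('I_m * T)%type) :
    layered S A B G -> (forall t, exists u, S u = t) ->
    (forall t, B t = 0%N /\ (0 < A t)%N) \/ (forall t, A t = 0%N /\ (0 < B t)%N) ->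
  num_circular G = 0%N /\ num_free_linear G = 0%N.
Proof.
move=> GP S_surj AB; apply: num_components_eq0 => _ /imsetP[x0 _ ->].
case: (arg_minnP (fun x : 'I_m * T => x.1 : nat) (mem_component G x0)) => -[i t] xC xmin.
have im := ltn_ord i; exists (i, t).
case: AB => AB.
  have nopred y : ~~ wd_edge G y (i, t).
    apply/negP => yx; have yC : y \in component G x0 by rewrite (edge_component _ yx).
    move: (xmin y yC); case: y yx {yC} => j u /(layered_edgeP GP)[/= _].
    by have [-> Au] := AB u; lia.
  split; [by [] | | by right].
  have [u ut] := S_surj t; have [Bu Au] := AB u.
  apply/(layered_markedP GP); right; exists u => //=; rewrite ltnNge; apply/negP => ge.
  have zm : (i - A u < m)%N by lia.
  by have /negP[] := nopred (Ordinal zm, u); apply/(layered_edgeP GP); split=> //=; lia.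
have nosucc y : ~~ wd_edge G (i, t) y.
  apply/negP => xy; have yC : y \in component G x0 by rewrite -(edge_component _ xy).
  move: (xmin y yC); case: y xy {yC} => j u /(layered_edgeP GP)[/= _].
  by have [-> Bt] := AB t; lia.
split; [by [] | | by left].
have [At Bt] := AB t.
apply/(layered_markedP GP); left => /=; rewrite ltnNge; apply/negP => ge.
have zm : (i - B t < m)%N by lia.
by have /negP[] := nosucc (Ordinal zm, S t); apply/(layered_edgeP GP); split=> //=; lia.
Qed.

(** * The digraphs [Gamma] as layered digraphs, and cyclic column indices *)

Lemma Gamma_layered m (eps : seq int) :
  size eps != 1%N -> layered (@ordS (size eps)) (@gamma_A eps) (@gamma_B eps) (Gamma m eps).
Proof.
move=> /negbTE s1; split=> [[i t] [j u]|[i t]] /=.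
  rewrite /gamma_edge s1; apply/existsP/and3P => /= [[v /existsP[l]]|[/eqP -> /eqP e lt]].
    move=> /and5P[h /eqP-> /eqP e /eqP-> /eqP e']; have := ltn_ord l.
    by rewrite eqxx; split=> //; lia.
  by exists t; apply/existsP; exists (Ordinal lt); rewrite /= !eqxx; lia.
have im := ltn_ord i.
rewrite /gamma_marked s1; apply/existsP/orP => /= [[v /existsP[l]]|].
  have lm := ltn_ord l; move=> /orP[] /and3P[h /eqP-> /eqP e]; [left|right]; first lia.
  by apply/existsP; exists v; rewrite eqxx; lia.
case=> [lt|/existsP[v /andP[/eqP <- lt]]].
  have lm : (i + gamma_A t < m)%N by lia.
  by exists t; apply/existsP; exists (Ordinal lm); rewrite /= eqxx; apply/orP; left; lia.
have lm : (i + gamma_B v < m)%N by lia.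
by exists v; apply/existsP; exists (Ordinal lm); rewrite /= eqxx; apply/orP; right; lia.
Qed.

Lemma Gamma_singleton m (e : int) :
  e != 0 -> num_circular (Gamma m [:: e]) = 0%N /\ num_free_linear (Gamma m [:: e]) = 0%N.
Proof.
move=> e0; apply: num_components_eq0 => _ /imsetP[x _ ->].
exists x; split; [exact: mem_component | by rewrite /= /gamma_marked | left => y].
by rewrite /= /gamma_edge /= (negbTE e0).
Qed.

Lemma ordS_surj n (t : 'I_n) : exists u, ordS u = t.
Proof. by exists (ord_pred t); rewrite ord_predK. Qed.

Lemma val_ordS n (t : 'I_n.+1) : ordS t = (if t == n :> nat then 0 else t.+1)%N :> nat.
Proof.
rewrite /=; have := ltn_ord t; case: eqP => [-> _|tn lt]; first by rewrite modnn.
by rewrite modn_small; lia.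
Qed.

Lemma codom_lift n (k : 'I_n.+1) (t : 'I_n.+1) : (t \in codom (lift k)) = (t != k).
Proof.
have [u ->|->] := unliftP k t; first by rewrite codom_f eq_sym neq_lift.
by rewrite eqxx; apply/negbTE/codomP => -[u /eqP]; rewrite (negbTE (neq_lift _ _)).
Qed.

(** * Merging two adjacent entries of equal sign *)

Section Merge.
Context (m : nat) (e1 e2 : int) (r : seq int).
Let n := size r.
Let eps := [:: e1, e2 & r].
Let eps' := e1 + e2 :: r.
Context (G : wdigraph (gamma_vertex m eps)) (G' : wdigraph (gamma_vertex m eps')).
Context (GP : layered (@ordS (size eps)) (@gamma_A eps) (@gamma_B eps) G)
  (GP' : layered (@ordS (size eps')) (@gamma_A eps') (@gamma_B eps') G').

(** The shifts [A] of columns 0 and 1 are [e1] and [e2], and they add up once column 1 is deleted,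
    with column 0 as [p]; the shifts [B] coming from [e1], [e2] and [e1 + e2] are all 0. *)
Lemma merge_positive : 0 < e1 -> 0 < e2 ->
  num_circular G = num_circular G' /\ num_free_linear G = num_free_linear G'.
Proof.
move=> e1p e2p; pose k : 'I_n.+2 := Ordinal (isT : (1 < n.+2)%N).
have gE (t : 'I_n.+1) : lift k t = (if t == 0 :> nat then 0 else t.+1)%N :> nat.
  by rewrite /= /bump; case: (val t).
have nthE (t : 'I_n.+1) : eps`_(lift k t) = if t == ord0 then e1 else eps'`_t.
  by rewrite gE -val_eqE /=; case: (val t).
have Sgp : ordS (lift k ord0) = k by apply: ord_inj; rewrite val_ordS gE.
have Sk : ordS k = lift k (ordS ord0).
  by apply: ord_inj; rewrite gE !val_ordS /=; case: (n).
have Sg (t : 'I_n.+1) : t != ord0 -> ordS (lift k t) = lift k (ordS t).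
  rewrite -val_eqE /= => /negbTE t0; apply: ord_inj; rewrite val_ordS !gE val_ordS t0 eqSS.
  by case: ifP.
have Bp : @gamma_B eps (lift k ord0) = 0%N.
  by rewrite /gamma_B Sgp /=; clear -e1p e2p; lia.
have S_inj N : injective (@ordS N) by exact: can_inj (@ordSK N).
apply: (layered_contraction GP GP' (S_inj _) (S_inj _) (@lift_inj _ k) (codom_lift k) Sgp Sk Sg);
  [ | | | | by right].
- by rewrite /gamma_A nthE /=; clear -e1p e2p; lia.
(* The equality case is that of empty [r], where the column after [p] is [p] itself. *)
- by rewrite Bp add0n /gamma_B Sk nthE; case: eqP => [->|_] //=; clear -e1p e2p; lia.
- by move=> t t0; rewrite /gamma_A nthE (negbTE t0).
- by move=> t t0; rewrite /gamma_B Sg // nthE; case: eqP => [->|_] //=; clear -e1p e2p; lia.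
Qed.

(** A negative entry acts through [B] of the preceding column: [- e1] belongs to the last column and
    [- e2] to column 0. Hence column 0 is deleted and [p] is the last column. *)
Lemma merge_negative : e1 < 0 -> e2 < 0 ->
  num_circular G = num_circular G' /\ num_free_linear G = num_free_linear G'.
Proof.
move=> e1n e2n; pose k : 'I_n.+2 := ord0.
have gE (t : 'I_n.+1) : lift k t = t.+1 :> nat by [].
have nthE (t : 'I_n.+1) : eps`_(lift k t) = if t == ord0 then e2 else eps'`_t.
  by rewrite gE -val_eqE /=; case: (val t).
have Sgp : ordS (lift k ord_max) = k by apply: ord_inj; rewrite val_ordS gE /= eqxx.
have Smax : ordS (ord_max : 'I_n.+1) = ord0 by apply: ord_inj; rewrite val_ordS eqxx.
have Sk : ordS k = lift k (ordS ord_max) by rewrite Smax; apply: ord_inj; rewrite gE val_ordS.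
have Sg (t : 'I_n.+1) : t != ord_max -> ordS (lift k t) = lift k (ordS t).
  by rewrite -val_eqE /= => /negbTE t0; apply: ord_inj; rewrite gE !val_ordS gE eqSS t0.
have Ak : @gamma_A eps k = 0%N by rewrite /gamma_A /=; clear -e1n e2n; lia.
have S_inj N : injective (@ordS N) by exact: can_inj (@ordSK N).
apply: (layered_contraction GP GP' (S_inj _) (S_inj _) (@lift_inj _ k) (codom_lift k) Sgp Sk Sg);
  [ | | | | by left].
- by rewrite Ak addn0 /gamma_A nthE; case: eqP => [->|_] //=; clear -e1n e2n; lia.
- by rewrite /gamma_B Sgp Sk nthE Smax /=; clear -e1n e2n; lia.
- by move=> t t0; rewrite /gamma_A nthE; case: eqP => [->|_] //=; clear -e1n e2n; lia.
- move=> t t0; rewrite /gamma_B Sg // nthE; case: eqP => [S0|_] //=.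
  by case/eqP: t0; apply: (can_inj (@ordSK _)); rewrite Smax.
Qed.

End Merge.

Theorem theorem3p5 (m : nat) (hm : (1 <= m)%N) (e1 e2 : int) (r : seq int)
    (h12 : 0 < e1 * e2) :
  num_circular (Gamma m [:: e1, e2 & r]) = num_circular (Gamma m (e1 + e2 :: r))
  /\ num_free_linear (Gamma m [:: e1, e2 & r])
     = num_free_linear (Gamma m (e1 + e2 :: r)).
Proof.
have same_sign : (0 < e1 /\ 0 < e2) \/ (e1 < 0 /\ e2 < 0).
  case: (ltrgtP e1 0) h12 => [e1n|e1p|->]; last by rewrite mul0r ltxx.
    by rewrite nmulr_rgt0 //; right.
  by rewrite pmulr_rgt0 //; left.
have GP := @Gamma_layered m [:: e1, e2 & r] isT.
(* With [r] nonempty both digraphs have at least two columns and are layered. With [r] empty both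
   sides are shown to vanish, the single entry [e1 + e2] being nonzero. *)
case: r GP => [|e3 r] GP; last first.
  have GP' := @Gamma_layered m [:: e1 + e2, e3 & r] isT.
  by case: same_sign => -[]; [exact: merge_positive GP GP' | exact: merge_negative GP GP'].
have [-> ->] : num_circular (Gamma m [:: e1 + e2]) = 0%N
               /\ num_free_linear (Gamma m [:: e1 + e2]) = 0%N by apply: Gamma_singleton; lia.
apply: (layered_one_sign GP); first exact: ordS_surj.
have nthP (P : int -> Prop) (t : 'I_2) : P e1 -> P e2 -> P [:: e1; e2]`_t.
  by case: t => -[|[]].
case: same_sign => -[e1s e2s]; [left|right] => t.
  split; first by apply: (nthP (fun e => absz (Num.max (- e) 0) = 0%N)) => /=; clear -e1s e2s; lia.
  by apply: (nthP (fun e => (0 < absz (Num.max e 0))%N)) => /=; clear -e1s e2s; lia.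
split; first by apply: (nthP (fun e => absz (Num.max e 0) = 0%N)) => /=; clear -e1s e2s; lia.
by apply: (nthP (fun e => (0 < absz (Num.max (- e) 0))%N)) => /=; clear -e1s e2s; lia.
Qed.
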